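(* Define polynomials $C_n \in \mathbb{Z}[x_1, x_2, \dotsc]$ for $n \geq 2$ by the recurrence $$C_2 = x_1^2, \qquad C_n = \mathcal{D} C_{n-1} \quad (n \geq 3),$$ where $$\mathcal{D} = \sum_{i=1}^\infty x_{i+1} \frac{\partial}{\partial x_i} + \sum_{i,j \geq 1} x_1 x_i x_j \frac{\partial}{\partial x_{i+j}} .$$ Then for every $n \geq 2$, $$C_n = \sum_{p \vdash n} Z_{\mathfrak{C}}(p) \prod_{i=1}^n x_i^{p(i)},$$ where the sum is over all partitions $p$ of $n$, $p(i)$ is the multiplicity of $i$ as a part of $p$, and $Z_{\mathfrak{C}}(p)$ is the number of circular permutations of $[n]$ whose run structure is $p$.
   Context: Write $[n] = \{1, \dotsc, n\}$. A circular permutation of $[n]$ is an arrangement of the elements of $[n]$ around an oriented circle (two arrangements are identified if they differ by a rotation, but not if they differ by a reflection). It can be written uniquely as a word $\sigma_1 \sigma_2 \cdots \sigma_n$ with $\sigma_1 = 1$, so there are $(n-1)!$ of them; set $\sigma(i) = \sigma_i$ and extend the indices periodically modulo $n$, so $\sigma(0) = \sigma(n)$, $\sigma(n+1) = \sigma(1)$, etc. A run of a circular permutation $\sigma$ of $[n]$ ($n \geq 2$) is an integer interval $\{i, i+1, \dotsc, j\}$ with $i<j$ (positions taken modulo $n$, intervals differing by a shift by a multiple of $n$ being identified) such that $\sigma(i), \sigma(i+1), \dotsc, \sigma(j)$ is a strictly monotone sequence (increasing or decreasing) and such that the interval cannot be extended in either direction with this property; its length is $j-i$. The lengths of all runs of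 $\sigma$ form a partition of $n$, called the run structure of $\sigma$. For example, the circular permutation of $[8]$ given by the word $14536782$ has the runs $145$, $53$, $3678$, $821$ of lengths $2,1,3,2$. The operator $\mathcal{D}$ is a formal infinite sum acting on polynomials in the variables $x_1, x_2, \dotsc$; on each polynomial only finitely many terms are nonzero. *)

(* Defs.v *)
From HB Require Import structures.
From mathcomp Require Import all_boot all_order all_algebra.
From mathcomp Require Import finmap.
From mathcomp Require Import boolp classical_sets functions cardinality fsbigop.
From mathcomp Require Import monalg.

Set Implicit Arguments.
Unset Strict Implicit.
Unset Printing Implicit Defensive.

Import GRing.Theory.
Local Open Scope ring_scope.

(* Z[x_1, x_2, ...], as the monoid algebra of the free commutative monoid on a
   countable set of generators.  Generator number k is x_{k+1}, so [xvar i] and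
   [pderiv i] are x_i and d/dx_i only for i >= 1 (index 0 is never used). *)
Definition polyZ := {malg int[{cmonom nat}]}.

Definition xvar (i : nat) : polyZ := << ucm i.-1 >>.

(* d/dx_i maps a * m to (a * e) * (m / x_i), where e is the exponent of x_i in
   the monomial m.  If e = 0 the truncated quotient [divcm] is multiplied by 0. *)
Definition pderiv (i : nat) (P : polyZ) : polyZ :=
  \sum_(m <- msupp P) << P@_m *+ m i.-1 *g divcm m (ucm i.-1) >>.

(* These are sums over infinite index sets of families with finite support:
   d/dx_k P = 0 as soon as x_k does not occur in P. *)
Definition opD (P : polyZ) : polyZ :=
  \sum_(i \in [set i : nat | (1 <= i)%N]) xvar i.+1 * pderiv i P
  + \sum_(ij \in [set ij : nat * nat | (1 <= ij.1)%N /\ (1 <= ij.2)%N])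
      xvar 1 * xvar ij.1 * xvar ij.2 * pderiv (ij.1 + ij.2)%N P.

Definition is_partition (n : nat) (p : seq nat) : bool :=
  [&& sorted geq p, 0%N \notin p & sumn p == n].

(* Each circular permutation of {1, ..., n} is represented by its unique word
   starting with 1; [permutations] enumerates words without repetition. *)
Definition circ_perms (n : nat) : seq (seq nat) :=
  [seq w <- permutations (iota 1 n) | head 0%N w == 1%N].

(* The value at position i of the word w, where positions are numbered from 1
   and extended periodically, so that position 0 is the last one. *)
Definition cval (w : seq nat) (i : nat) : nat :=
  nth 0%N w ((i + (size w).-1) %% size w).

(* The values at the positions i, i+1, ..., i+l are strictly monotone. *)
Definition monotone_at (w : seq nat) (i l : nat) : bool :=
  let s := [seq cval w k | k <- iota i l.+1] in sorted ltn s || sorted gtn s.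

(* {i, ..., i+l} is a run of length l (for i >= 1). *)
Definition is_run (w : seq nat) (i l : nat) : bool :=
  [&& (0 < l)%N, monotone_at w i l,
      ~~ monotone_at w i.-1 l.+1 & ~~ monotone_at w i l.+1].

(* Position intervals are taken up to shifts by n = size w, so each run has a
   unique representative starting in {1, ..., n}.  Bounding the length by n
   loses nothing: position i + n carries the same value as position i. *)
Definition run_lengths (w : seq nat) : seq nat :=
  [seq l | i <- iota 1 (size w), l <- [seq l <- iota 1 (size w) | is_run w i l]].

Definition run_structure (w : seq nat) : seq nat := sort geq (run_lengths w).

Definition Zcirc (n : nat) (p : seq nat) : nat :=
  count (fun w => run_structure w == p) (circ_perms n).

(* Main.v *)
(* Write a circular permutation w of [n] as a word starting with 1 and record the
   cyclic sequence of its ascents and descents.  Since 1 is the minimum, this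
   sign word starts with an ascent and ends with a descent, so that no run wraps
   around and the run lengths are the lengths of the maximal constant blocks of
   the sign word.  Inserting n+1 just before position t+1 replaces the t-th sign
   by an ascent followed by a descent, and every circular permutation of [n+1]
   arises exactly once in this way.  For a sign word consisting of k ascents and
   m descents, the weights of the n = k + m words so obtained add up to
   D(x_k x_m): inserting strictly inside a run of length k splits it into i, 1,
   k - i, while the two insertions next to the peak lengthen one of the two runs.
   As D is a derivation and weights are multiplicative, this extends to all sign
   words, whence the recurrence. *)

Require Import Defs.
From HB Require Import structures.
From mathcomp Require Import all_boot all_order all_algebra.
From mathcomp Require Import finmap.
From mathcomp Require Import boolp classical_sets functions cardinality fsbigop.
From mathcomp Require Import monalg.

Set Implicit Arguments.
Unset Strict Implicit.
Unset Printing Implicit Defensive.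

Import GRing.Theory.
Local Open Scope ring_scope.

(** * The operator D as a derivation *)

(* Sealed, as unification would otherwise try to decide equalities of monomials and
   of derivatives by unfolding finitely supported functions. *)
HB.lock Definition mon (c : int) (m : {cmonom nat}) : polyZ := << c *g m >>.
HB.lock Definition partial (i : nat) (P : polyZ) : polyZ := pderiv i P.

Lemma polyZ_ind (X : polyZ -> Prop) :
  X 0 -> (forall P Q, X P -> X Q -> X (P + Q)) ->
  (forall c m, X (mon c m)) -> forall P, X P.
Proof.
move=> X0 XD XU P; rewrite [P]monalgE; apply: big_ind => // m _.
by move: (XU P@_m m); rewrite mon.unlock.
Qed.

Lemma mon0 m : mon 0 m = 0.
Proof. rewrite mon.unlock; exact: monalgU0. Qed.

Lemma monD c1 c2 m : mon (c1 + c2) m = mon c1 m + mon c2 m.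
Proof. rewrite mon.unlock; exact: monalgUD. Qed.

Lemma monM c1 c2 m1 m2 : mon c1 m1 * mon c2 m2 = mon (c1 * c2) (mmul m1 m2).
Proof. rewrite mon.unlock; exact: fgmulUU. Qed.

(** Monomials outside the support contribute zero. Enlarging the index set lets the derivatives of
    [P], [Q] and [P + Q] be compared over one common set. *)
Lemma pderivEw (d : {fset {cmonom nat}}) i (P : polyZ) : (msupp P `<=` d)%fset ->
  pderiv i P = \sum_(m <- d) << P@_m *+ m i.-1 *g divcm m (ucm i.-1) >>.
Proof.
move=> le_d; apply: big_fset_incl => // m _ /mcoeff_outdom ->.
by rewrite mul0rn monalgU0.
Qed.

Lemma partial_mon i c m : partial i (mon c m) = mon (c *+ m i.-1) (divcm m (ucm i.-1)).
Proof.
by rewrite mon.unlock partial.unlock (pderivEw _ msuppU_le) big_seq_fset1 mcoeffUU.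
Qed.

Lemma partial0 i : partial i 0 = 0.
Proof. by rewrite partial.unlock /pderiv msupp0 big_seq_fset0. Qed.

Lemma partialD i : {morph partial i : P Q / P + Q}.
Proof.
move=> P Q; rewrite partial.unlock (pderivEw _ (msuppD_le _ _)).
rewrite (pderivEw _ (fsubsetUl (msupp P) (msupp Q))).
rewrite (pderivEw _ (fsubsetUr (msupp P) (msupp Q))) -big_split /=.
by apply: eq_bigr => m _; rewrite mcoeffD mulrnDl monalgUD.
Qed.

Section Derivations.
Variables (R : comNzRingType) (D : R -> R).
Hypothesis DD : {morph D : P Q / P + Q}.

(** The product rule is stated for one fixed pair, so that it can be extended by additivity one
    argument at a time, and so that an operator may be replaced by a truncation chosen for that
    pair. *)
Definition leibniz P Q := D (P * Q) = D P * Q + P * D Q.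

Lemma derivation0 : D 0 = 0.
Proof. by apply: (addrI (D 0)); rewrite -DD !addr0. Qed.

Lemma leibniz0 Q : leibniz 0 Q.
Proof. by rewrite /leibniz !mul0r derivation0 mul0r addr0. Qed.

Lemma leibnizC P Q : leibniz P Q -> leibniz Q P.
Proof. by rewrite /leibniz mulrC => ->; rewrite addrC ![_ * P]mulrC ![Q * _]mulrC. Qed.

Lemma leibnizDl P1 P2 Q : leibniz P1 Q -> leibniz P2 Q -> leibniz (P1 + P2) Q.
Proof. by rewrite /leibniz mulrDl !DD !mulrDl => -> ->; rewrite addrACA. Qed.

End Derivations.

Lemma divcm_mmul (m1 m2 : {cmonom nat}) k : m1 k != 0%N ->
  divcm (mmul m1 m2) (ucm k) = mmul (divcm m1 (ucm k)) m2.
Proof.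
move=> nz; apply/eqP/cmP => j; rewrite divcmE !cmM divcmE !cmU.
case: eqP => [<-|_]; last by rewrite !subn0.
by rewrite addnBAC // lt0n.
Qed.

(* If variable number k does not occur in m1, both coefficients vanish. *)
Lemma mon_divcm (m1 m2 : {cmonom nat}) c k :
  mon (c *+ m1 k) (divcm (mmul m1 m2) (ucm k)) =
  mon (c *+ m1 k) (mmul (divcm m1 (ucm k)) m2).
Proof.
by have [->|/divcm_mmul->//] := eqVneq (m1 k) 0%N; rewrite mulr0n !mon0.
Qed.

(** Both sides are biadditive, so monomials suffice; [leibnizC] swaps the factors to reduce the
    second one. For monomials the exponents of x_i add up, which gives the two terms. *)
Lemma partialM i P Q : leibniz (partial i) P Q.
Proof.
have DD := partialD i.
elim/polyZ_ind: P => [|P1 P2|a m]; [exact: leibniz0|exact: leibnizDl|].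
apply: leibnizC.
elim/polyZ_ind: Q => [|Q1 Q2|b m']; [exact: leibniz0|exact: leibnizDl|].
apply: leibnizC; rewrite /leibniz monM !partial_mon !monM cmM mulrnDr monD.
congr (_ + _); first by rewrite mulrnAl -mon_divcm.
by rewrite mulrnAr !(mulmC m) -mon_divcm.
Qed.

Lemma xvarE i : xvar i = mon 1 (ucm i.-1).
Proof. by rewrite mon.unlock. Qed.

Lemma mon1 : mon 1 mone = 1.
Proof. by rewrite mon.unlock. Qed.

Lemma partial_xvar i k : (0 < i)%N -> (0 < k)%N -> partial i (xvar k) = (i == k)%:R.
Proof.
case: i k => // i [//|k] _ _; rewrite xvarE partial_mon cmU eqSS eq_sym /=.
have [->|_] := eqVneq i k; last by rewrite mulr0n mon0.
rewrite mulr1n -mon1; congr mon; apply/eqP/cmP => j.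
by rewrite divcmE cm1 subnn.
Qed.

Lemma partial_bounded (P : polyZ) :
  exists B, forall i, (B <= i)%N -> partial i P = 0.
Proof.
elim/polyZ_ind: P => [|P Q [B HB] [B' HB']|c m].
- by exists 0%N => i _; rewrite partial0.
- exists (maxn B B') => i; rewrite geq_max => /andP[/HB Pi /HB' Qi].
  by rewrite partialD Pi Qi addr0.
(* One successor passes the largest generator number in [m], the other accounts for generator [k]
   being x_{k+1}. *)
exists (\max_(k <- finsupp m) k).+2 => -[//|i] Bi; rewrite partial_mon /=.
suff /eqP-> : m i == 0%N by rewrite mulr0n mon0.
rewrite cmE_eq0; apply: contraL Bi => im; rewrite -leqNgt ltnS.
by rewrite (big_rem _ im) /= leq_maxl.
Qed.

Lemma fsum_finite (I : choiceType) (r : seq I) (A : set I) (R : comNzRingType)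
    (F : I -> R) : uniq r -> (forall i, i \in r -> A i) ->
  (forall i, A i -> i \notin r -> F i = 0) ->
  \sum_(i \in A) F i = \sum_(i <- r) F i.
Proof.
move=> r_uniq rA F0; rewrite (fsbigE r) // big_seq_cond [RHS]big_seq.
by apply: eq_bigl => i; rewrite andb_idr // => /rA; rewrite inE.
Qed.

Definition pairs_lt (B : nat) : seq (nat * nat) :=
  [seq (i, j) | i <- index_iota 1 B, j <- index_iota 1 B].

Lemma mem_pairs_lt B i j :
  ((i, j) \in pairs_lt B) = [&& 0 < i, i < B, 0 < j & j < B]%N.
Proof.
apply/allpairsP/idP => [[[i' j'] [/= + + [-> ->]]]|].
  by rewrite !mem_index_iota => /andP[-> ->] /andP[-> ->].
by case/and4P=> i1 iB j1 jB; exists (i, j); rewrite !mem_index_iota i1 iB j1.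
Qed.

Definition opD_upto (B : nat) (P : polyZ) : polyZ :=
  \sum_(i <- index_iota 1 B) xvar i.+1 * partial i P
  + \sum_(ij <- pairs_lt B) xvar 1 * xvar ij.1 * xvar ij.2 * partial (ij.1 + ij.2) P.

(** A square of index pairs is enough for the second sum: if either index reaches [B], so does i +
    j, and the derivative with respect to x_{i+j} vanishes. *)
Lemma opD_bounded B P : (forall i, (B <= i)%N -> partial i P = 0) ->
  opD P = opD_upto B P.
Proof.
rewrite /opD_upto partial.unlock => HB; congr (_ + _).
  apply: fsum_finite; first exact: iota_uniq.
    by move=> i /=; rewrite mem_index_iota => /andP[].
  move=> i /= i1; rewrite mem_index_iota i1 /= -leqNgt => /HB ->.
  exact: mulr0.
apply: fsum_finite.
- by apply: allpairs_uniq => [||[i j] [i' j']]; rewrite ?iota_uniq.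
- by move=> [i j]; rewrite mem_pairs_lt => /and4P[].
move=> [i j] /= [i1 j1]; rewrite mem_pairs_lt i1 j1 /= => ij.
rewrite HB; first exact: mulr0.
by case/nandP: ij; rewrite -leqNgt => /leq_trans-> //; rewrite ?leq_addl ?leq_addr.
Qed.

Section Combinations.
Variables (R : comNzRingType) (I : Type) (r : seq I) (c : I -> R) (d : I -> R -> R).

Lemma combD : (forall i, {morph d i : P Q / P + Q}) ->
  {morph (fun P => \sum_(i <- r) c i * d i P) : P Q / P + Q}.
Proof.
by move=> dD P Q; rewrite -big_split; apply: eq_bigr => i _; rewrite dD mulrDr.
Qed.

Lemma combM P Q : (forall i, leibniz (d i) P Q) ->
  leibniz (fun P => \sum_(i <- r) c i * d i P) P Q.
Proof.
move=> dM; rewrite /leibniz mulr_suml mulr_sumr -big_split; apply: eq_bigr => i _.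
by rewrite dM mulrDr !mulrA [P * c i]mulrC.
Qed.

End Combinations.

Lemma leibnizD (R : comNzRingType) (D1 D2 : R -> R) P Q :
  leibniz D1 P Q -> leibniz D2 P Q -> leibniz (fun P => D1 P + D2 P) P Q.
Proof. by rewrite /leibniz => -> ->; rewrite mulrDl mulrDr addrACA. Qed.

Lemma opD_uptoD B : {morph opD_upto B : P Q / P + Q}.
Proof.
move=> P Q; rewrite /opD_upto.
have addD (a b c d : polyZ) : (a + c) + (b + d) = (a + b) + (c + d) by exact: addrACA.
rewrite -addD; congr (_ + _).
  by apply: (@combD _ _ _ _ (partial)); exact: partialD.
by apply: (@combD _ _ _ _ (fun ij => partial (ij.1 + ij.2))) => ij; exact: partialD.
Qed.

Lemma opD_uptoM B P Q : leibniz (opD_upto B) P Q.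
Proof.
apply: leibnizD.
  by apply: (@combM _ _ _ _ (partial)) => i; exact: partialM.
by apply: (@combM _ _ _ _ (fun ij => partial (ij.1 + ij.2))) => ij; exact: partialM.
Qed.

(** A single bound [B] valid for [P], [Q] and [P + Q] turns all three infinite sums into the same
    finite operator, which is additive. The product rule below is obtained likewise. *)
Lemma opDD : {morph opD : P Q / P + Q}.
Proof.
move=> P Q; have [B1 B1P] := partial_bounded P; have [B2 B2P] := partial_bounded Q.
have [B3 B3P] := partial_bounded (P + Q); set B := maxn B1 (maxn B2 B3).
rewrite !(@opD_bounded B) ?opD_uptoD // => i; rewrite !geq_max => /and3P[].
- by move=> _ /B2P.
- by move/B1P.
- by move=> _ _ /B3P.
Qed.

Lemma opDM P Q : leibniz opD P Q.
Proof.
have [B1 B1P] := partial_bounded P; have [B2 B2P] := partial_bounded Q.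
have [B3 B3P] := partial_bounded (P * Q); set B := maxn B1 (maxn B2 B3).
have E F : F = P \/ F = Q \/ F = P * Q -> opD F = opD_upto B F.
  case=> [|[]] ->; apply: opD_bounded => i; rewrite !geq_max => /and3P[].
  - by move/B1P.
  - by move=> _ /B2P.
  - by move=> _ _ /B3P.
rewrite /leibniz (E P); last by left.
rewrite (E Q); last by right; left.
rewrite (E (P * Q)); last by right; right.
exact: opD_uptoM.
Qed.

Section SumsAgainstDelta.
Variables (R : comNzRingType) (k : nat) (d : nat -> R).
Hypotheses (k0 : (0 < k)%N) (dE : forall i, (0 < i)%N -> d i = (i == k)%:R).

Lemma sum_iota_delta (F : nat -> R) :
  \sum_(i <- index_iota 1 k.+1) F i * d i = F k.
Proof.
rewrite big_nat_recr //= dE // eqxx mulr1 big_nat_cond big1 ?add0r // => i.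
by case/andP=> /andP[i0 ik] _; rewrite dE // ltn_eqF // mulr0.
Qed.

(** Here [d i] stands for the derivative of x_k with respect to x_i. For each i < k only j = k - i
    survives. *)
Lemma sum_pairs_delta (F : nat -> nat -> R) :
  \sum_(ij <- pairs_lt k.+1) F ij.1 ij.2 * d (ij.1 + ij.2)
  = \sum_(1 <= i < k) F i (k - i)%N.
Proof.
rewrite big_allpairs big_nat_recr //=.
(* The row i = k is empty because j >= 1 makes the index exceed k. *)
have -> : \sum_(1 <= j < k.+1) F k j * d (k + j) = 0.
  rewrite big_nat_cond big1 // => j; case/andP=> /andP[j1 _] _.
  by rewrite dE ?ltn_addr // gtn_eqF ?mulr0 // -addn1 leq_add2l.
rewrite addr0 big_nat_cond [RHS]big_nat_cond.
apply: eq_bigr => i; case/andP=> /andP[i1 ik] _.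
have ki : (k - i \in index_iota 1 k.+1)%N.
  by rewrite mem_index_iota subn_gt0 ik ltnS leq_subr.
rewrite (bigD1_seq _ ki (iota_uniq _ _)) /= subnKC ?(ltnW ik) // dE // eqxx mulr1.
rewrite big1 ?addr0 // => j; apply: contraNeq => ne.
have [<-|] := eqVneq (i + j)%N k; first by rewrite addKn.
by move=> /negPf e; rewrite dE ?ltn_addr // e mulr0 eqxx in ne.
Qed.

End SumsAgainstDelta.

(** Together with additivity and the product rule, this is all that the combinatorial part uses
    about [opD]. *)
Lemma opD_xvar k : (0 < k)%N ->
  opD (xvar k) = xvar k.+1 + \sum_(1 <= i < k) xvar 1 * xvar i * xvar (k - i).
Proof.
move=> k0.
have dE i : (0 < i)%N -> partial i (xvar k) = (i == k)%:R.
  by move=> i0; exact: partial_xvar.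
rewrite (@opD_bounded k.+1) => [|i ki]; last first.
  by rewrite dE ?(leq_trans _ ki) // gtn_eqF.
have E1 := sum_iota_delta k0 dE (fun i => xvar i.+1).
have E2 := sum_pairs_delta k0 dE (fun i j => xvar 1 * xvar i * xvar j).
exact: (congr2 (fun P Q : polyZ => P + Q) E1 E2).
Qed.
(** * Sign words *)

(** The accumulator is the open block: [k] signs equal to [b] have been read already. Starting from
    [true] and 0 records no empty block when [s] begins with an ascent. *)
Fixpoint blocks (b : bool) (k : nat) (s : seq bool) : seq nat :=
  if s is c :: s' then
    if c == b then blocks b k.+1 s' else k :: blocks c 1 s'
  else [:: k].

Lemma blocks_nseq b k m s : blocks b k (nseq m b ++ s) = blocks b (k + m) s.
Proof. by elim: m k => [|m IH] k /=; rewrite ?addn0 // eqxx IH addnS. Qed.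

(** A descent followed by an ascent always separates two blocks. For empty [s1] the hypothesis says
    that the open block is descending. *)
Lemma blocks_cat b k s1 s2 : ~~ last b s1 ->
  blocks b k (s1 ++ true :: s2) = blocks b k s1 ++ blocks true 1 s2.
Proof.
elim: s1 b k => [|c s1 IH] b k /=; first by case: b.
by case: eqP => [->|_] ls1; rewrite IH.
Qed.

Lemma sumn_blocks b k s : sumn (blocks b k s) = (k + size s)%N.
Proof.
elim: s b k => [|c s IH] b k /=; first by rewrite addn0.
by case: eqP => _ /=; rewrite IH ?addSnnS ?add1n.
Qed.

Lemma blocks_gt0 b k s : (0 < k)%N -> 0%N \notin blocks b k s.
Proof.
elim: s b k => [|c s IH] b k k0 /=; first by rewrite inE ltn_eqF.
by case: eqP => _; rewrite ?inE ?negb_or ?ltn_eqF //=; apply: IH.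
Qed.

(** Ascents are [true]. The default values exclude the empty word. *)
Definition updown (s : seq bool) := head false s && ~~ last true s.

Lemma updown_cons s : updown s -> exists s', s = true :: s' /\ ~~ last true s'.
Proof. by case: s => [|[] s] // /andP[_ ls]; exists s. Qed.

Definition peak (t : nat) (s : seq bool) : seq bool :=
  take t s ++ true :: false :: drop t.+1 s.

Lemma updown_peak t s : (t < size s)%N -> updown s -> updown (peak t s).
Proof.
case: s => // b s ts /andP[/= hs ls]; apply/andP; split.
  by case: t ts => //.
rewrite /peak last_cat /=; case: t ts => [|t] /= ts.
  by case: s ls {ts}.
rewrite -{1}(cat_take_drop t.+1 s) last_cat in ls.
by move: ls; case: (drop t.+1 s) => //.
Qed.

Lemma peak_cat_l t s1 s2 : (t < size s1)%N -> peak t (s1 ++ s2) = peak t s1 ++ s2.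
Proof.
move=> ts; rewrite /peak take_cat ts drop_cat -catA /=; case: ltnP => // s1t.
have -> : size s1 = t.+1 by apply/eqP; rewrite eqn_leq s1t.
by rewrite subnn drop0 [drop _ s1]drop_oversize.
Qed.

Lemma peak_cat_r t s1 s2 : peak (size s1 + t) (s1 ++ s2) = s1 ++ peak t s2.
Proof.
rewrite /peak take_cat drop_cat ltnNge leq_addr -addnS ltnNge leq_addr /= !addKn.
by rewrite catA.
Qed.

Lemma split_nseq b (s : seq bool) :
  exists k r, s = nseq k b ++ r /\ head (~~ b) r = ~~ b.
Proof.
elim: s => [|c s [k [r [-> hr]]]]; first by exists 0%N, [::].
have [->|ne] := eqVneq c b; first by exists k.+1, r.
by exists 0%N, (c :: nseq k b ++ r); split=> //=; case: c b ne {hr} => [] [].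
Qed.

(** Peeling off the first ascending and the first descending block leaves a word that, if not empty,
    again starts with an ascent and keeps the final descent. *)
Lemma updown_split s : updown s -> exists k m r,
  s = (nseq k.+1 true ++ nseq m.+1 false) ++ r /\ (r = [::] \/ updown r).
Proof.
move=> /updown_cons[s1 [-> ls]].
have [k [r [s1E]]] := split_nseq true s1.
case: r s1E => [|[] r] //= s1E _.
  by case/negP: ls; rewrite s1E cats0; elim: k {s1E}.
have [m [r' [rE hr']]] := split_nseq false r.
exists k, m, r'; rewrite s1E rE -catA; split => //.
case: r' rE hr' => [|[] r'] // rE _; [by left|right].
by move: ls; rewrite s1E rE /updown !(last_cat, last_cons).
Qed.

Lemma sum_shift (R : nmodType) a b (F : nat -> R) :
  \sum_(a <= t < a + b) F t = \sum_(0 <= t < b) F (a + t)%N.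
Proof.
by rewrite -{1}[a]add0n big_addn addKn; apply: eq_bigr => t _; rewrite addnC.
Qed.

(** * Total weight of all peak insertions *)

Section PeakSum.
Variables (R : comNzRingType) (x : nat -> R) (D : R -> R).
Hypothesis DM : forall P Q, leibniz D P Q.
Hypothesis Dx : forall k, (0 < k)%N ->
  D (x k) = x k.+1 + \sum_(1 <= i < k) x 1%N * x i * x (k - i)%N.

Definition weight (s : seq bool) : R := \prod_(l <- blocks true 0 s) x l.

Lemma weight_cat s1 s2 : updown s1 -> updown s2 ->
  weight (s1 ++ s2) = weight s1 * weight s2.
Proof.
move=> /updown_cons[s1' [-> ls1]] /updown_cons[s2' [-> ls2]].
by rewrite /weight /= blocks_cat // big_cat.
Qed.

Lemma updown_nseq k m : updown (nseq k.+1 true ++ nseq m.+1 false).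
Proof. by rewrite /updown /= last_cat /=; elim: m. Qed.

Lemma weight_nseq k m : weight (nseq k.+1 true ++ nseq m.+1 false) = x k.+1 * x m.+1.
Proof.
rewrite /weight blocks_nseq add0n /= -[nseq m false]cats0 blocks_nseq /=.
by rewrite !big_cons big_nil mulr1 add1n.
Qed.

Definition peak_sum (s : seq bool) : R := \sum_(0 <= t < size s) weight (peak t s).

(** This is the product rule for concatenation: a peak is inserted in exactly one of the two
    factors, and the weight is multiplicative because the modified factor is still up-down. *)
Lemma peak_sum_cat s1 s2 : updown s1 -> updown s2 ->
  peak_sum (s1 ++ s2) = peak_sum s1 * weight s2 + weight s1 * peak_sum s2.
Proof.
move=> ud1 ud2; rewrite /peak_sum size_cat (@big_cat_nat _ _ _ (size s1)) ?leq_addr //=.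
congr (_ + _).
  rewrite mulr_suml; apply: eq_big_nat => t /andP[_ ts].
  by rewrite peak_cat_l // weight_cat // updown_peak.
rewrite sum_shift mulr_sumr.
apply: eq_big_nat => t /andP[_ ts].
by rewrite peak_cat_r weight_cat // updown_peak.
Qed.

Lemma peak_nseq b k t : (t <= k)%N ->
  peak t (nseq k.+1 b) = nseq t b ++ true :: false :: nseq (k - t) b.
Proof. by move=> tk; rewrite /peak take_nseq ?drop_nseq // ltnW. Qed.

Lemma peak_sum_nseq k m :
  peak_sum (nseq k.+1 true ++ nseq m.+1 false) = D (x k.+1 * x m.+1).
Proof.
rewrite DM !Dx // /peak_sum size_cat !size_nseq.
rewrite (@big_cat_nat _ _ _ k.+1) ?leq_addr //.
(* Replacing ascent t < k splits the ascending block into t + 1, 1 and k - t, so i = t + 1.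
   Replacing the last ascent lengthens the descending block instead. *)
have -> : \sum_(0 <= t < k.+1) weight (peak t (nseq k.+1 true ++ nseq m.+1 false))
   = \sum_(1 <= i < k.+1) x 1%N * x i * x (k.+1 - i)%N * x m.+1 + x k.+1 * x m.+2.
  rewrite big_nat_recr // big_add1; congr (_ + _).
    apply: eq_big_nat => t /andP[_ tk].
    rewrite peak_cat_l ?size_nseq 1?ltnW // peak_nseq 1?ltnW //.
    have -> : (nseq t true ++ [:: true, false & nseq (k - t) true]) ++ nseq m.+1 false
       = (nseq t.+1 true ++ nseq 1 false) ++ (nseq (k - t.+1).+1 true ++ nseq m.+1 false).
      by rewrite -subSn // subSS -[t.+1]addn1 nseqD -!catA.
    rewrite weight_cat ?updown_nseq // !weight_nseq -subSn // subSS.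
    by rewrite mulrA [x t.+1 * _]mulrC.
  rewrite peak_cat_l ?size_nseq // peak_nseq // subnn /=.
  have -> : (nseq k true ++ [:: true; false]) ++ nseq m.+1 false
     = nseq k.+1 true ++ nseq m.+2 false.
    by rewrite -[k.+1]addn1 nseqD -!catA.
  by rewrite weight_nseq.
(* Replacing the first descent lengthens the ascending block. Replacing a later one, with t >= 1
   descents before it, splits the descending block into t, 1 and m + 1 - t. *)
have -> : \sum_(k.+1 <= t < k.+1 + m.+1) weight (peak t (nseq k.+1 true ++ nseq m.+1 false))
   = x k.+2 * x m.+1 + \sum_(1 <= i < m.+1) x k.+1 * (x 1%N * x i * x (m.+1 - i)%N).
  rewrite sum_shift big_ltn //; congr (_ + _).
    rewrite -{1}(size_nseq k.+1 true) peak_cat_r peak_nseq //.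
    have -> : nseq k.+1 true ++ nseq 0 false ++ [:: true, false & nseq (m - 0) false]
      = nseq k.+2 true ++ nseq m.+1 false.
      by rewrite subn0 -[k.+2]addn1 nseqD -catA.
    by rewrite weight_nseq.
  apply: eq_big_nat => -[//|t] /andP[_ tm].
  rewrite -{1}(size_nseq k.+1 true) peak_cat_r peak_nseq //.
  have -> : nseq k.+1 true ++ nseq t.+1 false ++ [:: true, false & nseq (m - t.+1) false]
     = (nseq k.+1 true ++ nseq t.+1 false) ++ (nseq 1 true ++ nseq (m - t.+1).+1 false).
    by rewrite -catA.
  rewrite weight_cat ?updown_nseq // !weight_nseq -subSn // -mulrA; congr (_ * _).
  by rewrite mulrA [x t.+1 * _]mulrC.
(* The two lengthening terms appear in the opposite order in the product rule. *)
rewrite mulrDl mulrDr mulr_suml mulr_sumr [LHS]addrA [RHS]addrA; congr (_ + _).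
by rewrite addrC addrA.
Qed.

(** Induction on the length: both sides obey the same product rule and agree on a single pair of
    blocks. *)
Lemma peak_sumE s : updown s -> peak_sum s = D (weight s).
Proof.
have [n] := ubnP (size s); elim: n s => // n IH s sn ud.
have [k [m [r [sE [r0|udr]]]]] := updown_split ud.
  by rewrite sE r0 cats0 peak_sum_nseq weight_nseq.
rewrite sE peak_sum_cat ?(weight_cat _ udr) ?updown_nseq //.
rewrite DM peak_sum_nseq weight_nseq IH //.
move: sn; rewrite sE !size_cat !size_nseq ltnS; apply: leq_trans.
by rewrite -[X in (X < _)%N]add0n ltn_add2r addSn.
Qed.

End PeakSum.
(** * Runs of circular permutations *)

Section RunsOfSigns.
Variables (f : nat -> bool) (n : nat).

Definition constant_at (i l : nat) := all (fun j => f j == f i) (iota i l).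

Definition runs_at (i : nat) : seq nat :=
  [seq l <- iota 1 n |
    [&& (0 < l)%N, constant_at i l, ~~ constant_at i.-1 l.+1 & ~~ constant_at i l.+1]].

Lemma constant_atP i l :
  reflect (forall j, (i <= j < i + l)%N -> f j = f i) (constant_at i l).
Proof.
apply: (iffP allP) => H j; first by rewrite -mem_iota => /H /eqP.
by rewrite mem_iota => /H ->.
Qed.

(** Any constant interval starting at [i] could be extended to the left. *)
Lemma runs_at_none i : (0 < i)%N -> f i.-1 = f i -> runs_at i = [::].
Proof.
case: i => // i _ /= e; rewrite /runs_at (eq_filter (a2 := pred0)) ?filter_pred0 // => l.
apply/negP => /and4P[l0 /constant_atP cl /constant_atP[]] j /andP[].
rewrite leq_eqVlt => /predU1P[<- //|ij]; rewrite addnS => jl; rewrite e.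
by apply: cl; rewrite ij addSn.
Qed.

Lemma runs_at_one i l : (0 < i)%N -> (0 < l <= n)%N ->
    (forall j, (i <= j < i + l)%N -> f j = f i) ->
  f i.-1 != f i -> f (i + l)%N != f i -> runs_at i = [:: l].
Proof.
move=> i0 ln cl ne1 ne2.
rewrite /runs_at -[RHS](@filter_pred1_uniq _ (iota 1 n)) ?iota_uniq ?mem_iota ?add1n ?ltnS //.
apply: eq_in_filter => k; rewrite mem_iota => /andP[k0 _] /=.
apply/and4P/eqP => [[_ /constant_atP ck _ /constant_atP ck1]|->].
  have [kl|lk|//] := ltngtP k l.
    case: ck1 => j /andP[ij jk]; apply: cl; rewrite ij (leq_trans jk) //.
    by rewrite leq_add2l.
  by case/eqP: ne2; apply: ck; rewrite leq_addr ltn_add2l.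
split; [by case/andP: ln|exact/constant_atP| |].
  apply/constant_atP => c; case/eqP: ne1; symmetry; apply: c.
  by rewrite leq_pred addnS ltnS -{1}(prednK i0) -addn1 leq_add2l; case/andP: ln.
by apply/constant_atP => c; case/eqP: ne2; apply: c; rewrite leq_addr addnS ltnS /=.
Qed.

Hypothesis fn : f n.+1 != f n.

(** Scanning invariant: the open block started at [a], and the signs before [p] have been read. The
    induction is on the number of unread signs. *)
Lemma runs_blocks a p : (0 < a < p)%N -> (p <= n.+1)%N ->
    (forall j, (a <= j < p)%N -> f j = f a) -> f a.-1 != f a ->
  runs_at a ++ flatten [seq runs_at i | i <- iota p (n.+1 - p)]
  = blocks (f a) (p - a) [seq f j | j <- iota p (n.+1 - p)].
Proof.
move=> ap pn; move Ed: (n.+1 - p)%N => d.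
have {Ed} pE : (p + d = n.+1)%N by rewrite -Ed subnKC.
elim: d a p ap pn pE => [|d IH] a p /andP[a0 ap] pn pE ca ne /=.
  (* No signs are left: p = n + 1, and [fn] closes the open block. *)
  rewrite cats0; apply: runs_at_one => //; rewrite ?subnKC ?(ltnW ap) //.
    by rewrite subn_gt0 ap leq_subLR (leq_trans pn) // -add1n leq_add2r.
  rewrite addn0 in pE; move: fn; rewrite -pE [f n]ca //; move: ap; rewrite pE ltnS => ->.
  exact: leqnn.
have p0 : (0 < p)%N by apply: leq_trans ap.
have pn' : (p.+1 <= n.+1)%N by rewrite -pE addnS ltnS leq_addr.
have cp : f p.-1 = f a.
  by apply: ca; rewrite -ltnS prednK // ap leqnn.
(* Either the sign at [p] prolongs the open block and no run starts there, or the block closes with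
   length p - a and a new one opens at [p]. *)
have [fpa|fpa] := eqVneq (f p) (f a).
  rewrite (@runs_at_none p) //=; last by rewrite cp.
  rewrite -subSn ?(ltnW ap) //; apply: IH => //.
  - by rewrite a0 ltnS ltnW.
  - by rewrite addSnnS.
  move=> j; rewrite ltnS => /andP[aj]; rewrite leq_eqVlt => /predU1P[->//|jp].
  by apply: ca; rewrite aj.
rewrite (@runs_at_one a (p - a)) ?subnKC ?(ltnW ap) //; last first.
  by rewrite subn_gt0 ap leq_subLR (leq_trans pn) // -add1n leq_add2r.
rewrite -[in RHS](subSnn p) cat1s; congr cons; apply: IH => //.
- by rewrite p0 leqnn.
- by rewrite addSnnS.
- by move=> j; rewrite ltnS -eqn_leq => /eqP->.
by rewrite cp eq_sym.
Qed.

End RunsOfSigns.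

(** * Insertion of the maximum into a circular permutation *)

Lemma mem_circ_perms n w :
  (w \in circ_perms n) = (head 0%N w == 1%N) && perm_eq w (iota 1 n).
Proof. by rewrite mem_filter mem_permutations. Qed.

Lemma circ_perms_size n w : w \in circ_perms n -> size w = n.
Proof. by rewrite mem_circ_perms => /andP[_ /perm_size->]; rewrite size_iota. Qed.

Lemma circ_perms_uniq n w : w \in circ_perms n -> uniq w.
Proof. by rewrite mem_circ_perms => /andP[_ /perm_uniq->]; rewrite iota_uniq. Qed.

Lemma circ_perms_mem n w v : w \in circ_perms n -> (v \in w) = (0 < v <= n)%N.
Proof.
by rewrite mem_circ_perms => /andP[_ /perm_mem->]; rewrite mem_iota add1n ltnS.
Qed.

Lemma circ_perms_cons n w : w \in circ_perms n ->
  exists w', w = 1%N :: w' /\ 1%N \notin w'.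
Proof.
move=> wn; move: (circ_perms_uniq wn); rewrite mem_circ_perms in wn.
by case: w wn => [|a w] //= /andP[/eqP-> _] /andP[nw _]; exists w.
Qed.

(** Cutting after t + 1 entries keeps 1 in front. For t = n - 1 the new entry goes to the end, that
    is, between the last entry and 1 on the circle. *)
Definition insert_max (n : nat) (w : seq nat) (t : nat) : seq nat :=
  take t.+1 w ++ n.+1 :: drop t.+1 w.

(** The inverse map deletes n + 1; both lists are duplicate-free, so it suffices to compare their
    members. *)
Lemma circ_permsS n : (0 < n)%N ->
  perm_eq (circ_perms n.+1) [seq insert_max n w t | w <- circ_perms n, t <- iota 0 n].
Proof.
move=> n0; apply: uniq_perm.
- by rewrite filter_uniq // permutations_uniq.
- apply: allpairs_uniq; rewrite ?iota_uniq ?filter_uniq ?permutations_uniq //.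
  have notin w k : w \in circ_perms n -> n.+1 \notin take k w.
    move=> wn; apply: contraTN (wn) => /mem_take; rewrite (circ_perms_mem _ wn).
    by rewrite ltnn.
  move=> [w t] [w' t'] /allpairsP[[v s] [/= wn sn [-> ->]]].
  move=> /allpairsP[[v' s'] [/= wn' sn' [-> ->]]] /= e.
  (* The insertion place can be read off from the position of n + 1, which does not occur in the
     original word. *)
  have idx u k : u \in circ_perms n -> k \in iota 0 n ->
      index n.+1 (insert_max n u k) = k.+1.
    move=> un; rewrite mem_iota => kn; rewrite index_cat (negPf (notin _ _ un)).
    by rewrite /= eqxx addn0 size_takel // (circ_perms_size un).
  have [ss] : s.+1 = s'.+1 by rewrite -(idx v s) // e idx.
  subst s'; congr pair.
  move/eqP: e; rewrite eqseq_cat; last first.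
    by rewrite !size_take (circ_perms_size wn) (circ_perms_size wn').
  case/andP=> /eqP e1 /eqP[e2].
  by rewrite -(cat_take_drop s.+1 v) e1 e2 cat_take_drop.
have iotaE : perm_eq (iota 1 n.+1) (n.+1 :: iota 1 n).
  by have := iotaD 1 n 1; rewrite addn1 add1n cats1 => ->; rewrite perm_rcons.
move=> w; apply/idP/allpairsP => [|[[v t] [/= vn tn ->]]].
  move=> wn; have [w1 [wE _]] := circ_perms_cons wn.
  have : n.+1 \in w by rewrite (circ_perms_mem _ wn) ltnS leqnn.
  rewrite wE inE eqSS eqn0Ngt n0 /= => nw.
  case/splitPr: nw wE => p1 p2 wE.
  exists (1%N :: p1 ++ p2, size p1); split.
  - move: wn; rewrite !mem_circ_perms wE => /andP[_ wp]; apply/andP; split=> //.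
    rewrite -(perm_cons n.+1) -(permPr iotaE) -(permPr wp).
    by rewrite -cat_cons -cat1s perm_catCA.
  - move: (circ_perms_size wn); rewrite wE /= size_cat /= addnS => -[<-].
    by rewrite mem_iota add0n ltnS leq_addr.
  - by rewrite /insert_max /= take_size_cat // drop_size_cat.
move: (vn); rewrite !mem_circ_perms => /andP[hv vp]; apply/andP; split.
  by case: v hv {vn vp}.
rewrite (permPr iotaE) /insert_max -cat1s perm_catCA cat_take_drop.
by rewrite perm_cons.
Qed.

(** The first entry is appended again to close the circle, so the last sign compares the last entry
    with the first. *)
Definition signs (w : seq nat) : seq bool :=
  pairmap ltn (head 0%N w) (rcons (behead w) (head 0%N w)).

Lemma size_signs w : (0 < size w)%N -> size (signs w) = size w.
Proof. by case: w => // a w _; rewrite size_pairmap size_rcons. Qed.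

(** The new entry exceeds both of its neighbours, so the sign between them becomes an ascent
    followed by a descent; all other signs are unchanged. *)
Lemma signs_insert_max n w t : w \in circ_perms n -> (t < n)%N ->
  signs (insert_max n w t) = peak t (signs w).
Proof.
move=> wn tn; have [w' [wE _]] := circ_perms_cons wn; subst w.
have lt_max v : v \in 1%N :: w' -> (v < n.+1)%N.
  by rewrite (circ_perms_mem _ wn) ltnS => /andP[].
have szw : (t <= size w')%N by move: tn; rewrite -(circ_perms_size wn) /= ltnS.
rewrite /insert_max /signs /= rcons_cat /=.
(* [h] is the right neighbour of the inserted maximum: the next entry, or the closing 1. *)
have [h [z zE]] : exists h z, rcons (drop t w') 1%N = h :: z.
  by case: (drop t w') => [|h z]; [exists 1%N, [::]|exists h, (rcons z 1%N)].
have hmem : h \in 1%N :: w'.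
  have: h \in rcons (drop t w') 1%N by rewrite zE mem_head.
  by rewrite mem_rcons !inE => /orP[->//|/mem_drop->]; rewrite orbT.
have lmem : last 1%N (take t w') \in 1%N :: w'.
  have := mem_last 1%N (take t w'); rewrite !inE => /orP[->//|/mem_take->].
  by rewrite orbT.
rewrite -[in RHS](cat_take_drop t w') rcons_cat zE !pairmap_cat /= /peak.
have szt : size (pairmap ltn 1%N (take t w')) = t by rewrite size_pairmap size_takel.
rewrite take_size_cat // drop_cat szt ifF ?subSnn /=; last by rewrite ltnNge leqnSn.
rewrite drop0 (lt_max _ lmem); congr (_ ++ _ :: _ :: _).
by apply/negbTE; rewrite -leqNgt ltnW // lt_max.
Qed.

(** * Runs of a circular permutation as blocks of its sign word *)

Section RunsOfWord.
Variables (n : nat) (w : seq nat).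
Hypotheses (n2 : (1 < n)%N) (wn : w \in circ_perms n).

Definition ascent (i : nat) : bool := (cval w i < cval w i.+1)%N.

Lemma cval_neq i : cval w i != cval w i.+1.
Proof.
rewrite /cval (circ_perms_size wn) nth_uniq ?(circ_perms_uniq wn) //; last first.
- by rewrite (circ_perms_size wn) ltn_mod (ltnW n2).
- by rewrite (circ_perms_size wn) ltn_mod (ltnW n2).
rewrite addSn -addn1 -{1}[(i + n.-1)%N]addn0 eqn_modDl mod0n modn_small //.
Qed.

Lemma cval_head : cval w n.+1 = head 0%N w.
Proof.
rewrite /cval (circ_perms_size wn) addSnnS prednK ?(ltnW n2) // addnn -muln2 modnMr.
by rewrite nth0.
Qed.

Lemma cval_nth i : (0 < i <= n)%N -> cval w i = nth 0%N w i.-1.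
Proof.
case: i => // i ni; rewrite /cval (circ_perms_size wn) addSnnS prednK ?(ltnW n2) //.
by rewrite modnDr modn_small.
Qed.

Lemma ascent_signs : [seq ascent i | i <- iota 1 n] = signs w.
Proof.
have [w' [wE _]] := circ_perms_cons wn; have szw := circ_perms_size wn.
apply: (@eq_from_nth _ false); first by rewrite size_signs ?size_map ?size_iota ?szw // ltnW.
move=> i; rewrite size_map size_iota => ni.
rewrite (nth_map 0%N) ?size_iota // nth_iota // add1n /ascent.
rewrite /signs (nth_pairmap 0%N); last by rewrite size_rcons wE /= -szw wE in ni *.
rewrite cval_nth //=; congr (_ < _)%N.
  by rewrite wE -cats1 -cat_cons nth_cat -wE szw ni.
have [i1n|ni1] := ltnP i.+1 n.
  rewrite cval_nth //= wE /= nth_rcons ifT //.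
  by move: i1n; rewrite -szw wE.
have -> : i.+1 = n by apply/eqP; rewrite eqn_leq ni.
rewrite cval_head wE /= nth_rcons.
have -> : i = size w'.
  by move: szw; rewrite wE /= => szw; apply/eqP; rewrite -eqSS szw eqn_leq ni.
by rewrite ltnn eqxx.
Qed.

(** Neighbouring values differ, so a step that is not an ascent is a strict descent. *)
Lemma monotone_atE i l : (0 < l)%N -> monotone_at w i l = constant_at ascent i l.
Proof.
have sortedE (e : rel nat) j k : sorted e [seq cval w m | m <- iota j k.+1] =
    all (fun m => e (cval w m) (cval w m.+1)) (iota j k).
  by elim: k j => [|k IH] j //=; rewrite -IH.
rewrite /monotone_at; case: l => // l _; rewrite !sortedE /constant_at /= eqxx.
have gtE m : (cval w m > cval w m.+1)%N = ~~ ascent m.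
  by rewrite /ascent -leqNgt [RHS]leq_eqVlt eq_sym (negPf (cval_neq m)).
rewrite gtE -/(ascent i) (eq_all gtE); case: (ascent i) => /=.
  by rewrite orbF; apply: eq_all => m; rewrite eqb_id.
by apply: eq_all => m; rewrite eqbF_neg.
Qed.

Lemma nth_gt1 i : (0 < i < n)%N -> (1 < nth 0%N w i)%N.
Proof.
have [w' [wE w'1]] := circ_perms_cons wn; have szw := circ_perms_size wn.
case: i => // i; rewrite wE /= -szw wE ltnS => iw.
have: nth 0%N w' i \in w by rewrite wE inE mem_nth ?orbT.
rewrite (circ_perms_mem _ wn) => /andP[v0 _]; rewrite ltn_neqAle v0 andbT.
by apply: contraNneq w'1 => ->; rewrite mem_nth.
Qed.

(** The value 1 is the minimum and sits at positions 1 and n + 1: steps out of it ascend and steps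
    into it descend. *)
Lemma ascent_ends :
  [/\ ascent 0 = false, ascent 1 = true, ascent n = false & ascent n.+1 = true].
Proof.
have n0 : (0 < n)%N by apply: ltnW.
have h1 : head 0%N w = 1%N by move: wn; rewrite mem_circ_perms => /andP[/eqP].
have last_gt1 : (1 < nth 0%N w n.-1)%N.
  by apply: nth_gt1; rewrite -ltnS !prednK // n2 leqnn.
have c1 : cval w 1 = 1%N by rewrite cval_nth ?n0 //= nth0.
have c2 : (1 < cval w 2)%N by rewrite cval_nth // nth_gt1.
have cn : cval w n = nth 0%N w n.-1 by rewrite cval_nth // n0 leqnn.
have cS k : cval w (n + k) = cval w k.
  by rewrite /cval (circ_perms_size wn) -addnA modnDl.
have c0 := cS 0%N; have cn1 := cS 1%N; have cn2 := cS 2%N.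
rewrite addn0 addn1 addn2 in c0 cn1 cn2.
rewrite /ascent cn2 cn1 -c0 c1 cn c2; split=> //.
all: by apply/negbTE; rewrite -leqNgt ltnW.
Qed.

Lemma run_lengths_blocks : run_lengths w = blocks true 0 (signs w).
Proof.
have [a0 a1 an an1] := ascent_ends; have szw := circ_perms_size wn.
have rE i : [seq l <- iota 1 n | is_run w i l] = runs_at ascent n i.
  apply: eq_filter => l; rewrite /is_run; case: l => // l.
  by rewrite !monotone_atE.
rewrite /run_lengths -ascent_signs szw.
rewrite (eq_map (g := fun i => runs_at ascent n i)); last first.
  by move=> i /=; rewrite rE map_id.
(* The scan starts with the sign at position 1 read: it opens a block because position 0 is a
   descent. The ascent at n + 1 closes the last block. *)
have := @runs_blocks ascent n _ 1 2; rewrite a0 a1 an an1.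
case: (n) n2 => // m _; rewrite subSS subn1 /= a1 => -> // j.
by case: j => [|[|]].
Qed.

Lemma updown_signs : updown (signs w).
Proof.
have [_ a1 an _] := ascent_ends; rewrite -ascent_signs /updown.
case: (n) n2 an => [|[|m]] // _ an; have := iotaD 1 m.+1 1; rewrite addn1 add1n => ->.
by rewrite map_cat last_cat /= an a1.
Qed.

End RunsOfWord.

Lemma run_structure_partition n w : (1 < n)%N -> w \in circ_perms n ->
  is_partition n (run_structure w).
Proof.
move=> n2 wn; have pw : perm_eq (run_structure w) (run_lengths w) by rewrite perm_sort.
apply/and3P; split; first by apply: sort_sorted => a b; exact: leq_total.
  rewrite (perm_mem pw) (run_lengths_blocks n2 wn).
  have [s [-> _]] := updown_cons (updown_signs n2 wn).
  by rewrite /= blocks_gt0.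
rewrite (perm_sumn pw) (run_lengths_blocks n2 wn) sumn_blocks add0n.
by rewrite size_signs (circ_perms_size wn) // ltnW.
Qed.

(** * Summation over circular permutations and over partitions *)

Section CircSum.
Variables (R : comNzRingType) (x : nat -> R) (D : R -> R).

Lemma prod_count_mem n (p : seq nat) : all (fun l => 0 < l < n.+1)%N p ->
  \prod_(1 <= i < n.+1) x i ^+ count_mem i p = \prod_(l <- p) x l.
Proof.
elim: p => [|l p IH] /=; first by rewrite big_nil big1.
case/andP=> ln pn; rewrite big_cons -IH //.
under eq_bigr do rewrite exprD.
rewrite big_split /= (bigD1_seq l) ?mem_index_iota ?iota_uniq //= eqxx expr1.
by rewrite [X in _ * X * _]big1 ?mulr1 // => i /negPf il; rewrite eq_sym il.
Qed.

Lemma is_partition_bounds n p : is_partition n p -> all (fun l => 0 < l < n.+1)%N p.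
Proof.
case/and3P=> _ p0 /eqP <-; apply/allP => l lp; apply/andP; split.
  by rewrite lt0n; apply: contraNneq p0 => <-.
by rewrite ltnS sumnE (big_rem _ lp) /= leq_addr.
Qed.

Definition circ_sum (n : nat) : R :=
  \sum_(w <- circ_perms n) \prod_(l <- run_lengths w) x l.

(** Partitions that are no run structure have coefficient 0. Over the others, counts become sums of
    indicators; after exchanging the sums, each word selects its own run structure. *)
Lemma partition_sum n : (1 < n)%N ->
  \sum_(p \in [set p : seq nat | is_partition n p])
     (Zcirc n p)%:R * \prod_(1 <= i < n.+1) x i ^+ count_mem i p = circ_sum n.
Proof.
move=> n2; rewrite (@fsum_finite _ (undup (map run_structure (circ_perms n)))) ?undup_uniq //.
- rewrite /circ_sum.
  under eq_bigr => p _ do rewrite /Zcirc -sum1_count natr_sum big_mkcond mulr_suml.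
  rewrite exchange_big /= big_seq [RHS]big_seq; apply: eq_bigr => w wn.
  have wr : run_structure w \in undup (map run_structure (circ_perms n)).
    by rewrite mem_undup map_f.
  rewrite (bigD1_seq _ wr (undup_uniq _)) /= eqxx mul1r prod_count_mem; last first.
    exact/is_partition_bounds/run_structure_partition.
  rewrite [X in _ + X]big1 ?addr0; first by apply: perm_big; rewrite perm_sort.
  by move=> p; rewrite eq_sym => /negPf->; rewrite mul0r.
- by move=> p; rewrite mem_undup => /mapP[w wn ->] /=; exact: run_structure_partition.
move=> p _; rewrite mem_undup => pn; rewrite /Zcirc (_ : count _ _ = 0%N) ?mul0r //.
apply/eqP; rewrite -leqn0 leqNgt -has_count; apply: contra pn => /hasP[w wn /eqP<-].
exact: map_f.
Qed.

Hypothesis DD : {morph D : P Q / P + Q}.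
Hypothesis DM : forall P Q, leibniz D P Q.
Hypothesis Dx : forall k, (0 < k)%N ->
  D (x k) = x k.+1 + \sum_(1 <= i < k) x 1%N * x i * x (k - i)%N.

(** Words are grouped by the permutation left after deleting n + 1; each group is a [peak_sum]. *)
Lemma circ_sumS n : (1 < n)%N -> circ_sum n.+1 = D (circ_sum n).
Proof.
move=> n2; have n0 := ltnW n2; have n2' : (1 < n.+1)%N by [].
rewrite /circ_sum (big_morph D DD (derivation0 DD)).
rewrite (perm_big _ (circ_permsS n0)) big_allpairs_dep big_seq [RHS]big_seq.
apply: eq_bigr => w wn; rewrite (run_lengths_blocks n2 wn).
rewrite -[\prod_(l <- _) _]/(weight x (signs w)) -(peak_sumE DM Dx (updown_signs n2 wn)).
rewrite /peak_sum size_signs (circ_perms_size wn) //.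
rewrite /index_iota subn0; apply: eq_big_seq => t tn.
rewrite (run_lengths_blocks n2'); last first.
  by rewrite (perm_mem (circ_permsS n0)); apply/allpairsP; exists (w, t).
by rewrite (signs_insert_max wn) //; move: tn; rewrite mem_iota.
Qed.

Lemma circ_sum2 : circ_sum 2 = x 1%N ^+ 2.
Proof.
(* The only circular permutation is 12, with two runs of length 1. *)
have -> : circ_sum 2 = \sum_(w <- [:: [:: 1; 2]%N]) \prod_(l <- run_lengths w) x l.
  by [].
by rewrite big_seq1 /run_lengths /= !big_cons big_nil mulr1 expr2.
Qed.

End CircSum.

Theorem proposition5 (C : nat -> polyZ)
  (hC2 : C 2%N = xvar 1 ^+ 2)
  (hC : forall n : nat, (3 <= n)%N -> C n = opD (C n.-1)) :
  forall n : nat, (2 <= n)%N ->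
    C n = \sum_(p \in [set p : seq nat | is_partition n p])
            (Zcirc n p)%:R * \prod_(1 <= i < n.+1) xvar i ^+ count_mem i p.
Proof.
move=> n n2; transitivity (circ_sum xvar n); last exact/esym/partition_sum.
elim: n n2 => [|[|[|n]] IH] // _.
  by rewrite hC2; exact/esym/circ_sum2.
rewrite hC // IH //; symmetry; apply: circ_sumS => //.
- exact: opDD.
- exact: opDM.
exact: opD_xvar.
Qed.
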